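(* Let $\alpha\in[0,1]$, let $\mathcal{X}$ and $\mathcal{Y}$ be finite alphabets, let $P_{XY}$ be a joint distribution on $\mathcal{X}\times\mathcal{Y}$ with $X$-marginal $P_X$, and let $E\subseteq\mathcal{X}\times\mathcal{Y}$ be an event such that for all $y\in\mathcal{Y}$, $P_X(E_y)\le\alpha$, where $E_y:=\{x:(x,y)\in E\}$. Then $$P_{XY}(E)\le\alpha\exp\{\mathcal{L}(X\to Y)\},$$ where $$\mathcal{L}(X\to Y)=\log\sum_{y\in\mathcal{Y}}\ \max_{x:\,P_X(x)>0}P_{Y|X}(y|x)$$ is the maximal leakage from $X$ to $Y$.
   Context: Logarithms are natural. $P_{Y|X}(y|x)=P_{XY}(x,y)/P_X(x)$ for $P_X(x)>0$ is the conditional distribution of $Y$ given $X$. *)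

(* Defs.v *)
From mathcomp Require Import all_boot all_order all_algebra.
From mathcomp Require Import reals sequences exp.

Set Implicit Arguments.
Unset Strict Implicit.
Unset Printing Implicit Defensive.

Import Order.TTheory GRing.Theory Num.Theory.
Local Open Scope ring_scope.

Definition is_dist (R : realType) (T : finType) (P : T -> R) : Prop :=
  (forall t, 0 <= P t) /\ \sum_(t : T) P t = 1.

Definition Pr (R : realType) (T : finType) (P : T -> R) (A : {set T}) : R :=
  \sum_(t in A) P t.

Definition marginalX (R : realType) (X Y : finType) (P : X * Y -> R) (x : X) : R :=
  \sum_(y : Y) P (x, y).

(* P_{Y|X}(y|x); meaningful only when [0 < marginalX P x]. *)
Definition condYX (R : realType) (X Y : finType) (P : X * Y -> R)
    (y : Y) (x : X) : R :=
  P (x, y) / marginalX P x.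

(* When P is a distribution, the range of the maximum is nonempty and the
   values are nonnegative, so the default value 0 of the iterated maximum does
   not affect the result. *)
Definition maximal_leakage (R : realType) (X Y : finType) (P : X * Y -> R) : R :=
  ln (\sum_(y : Y) \big[Order.max/0]_(x : X | 0 < marginalX P x) condYX P y x).

Definition fiber (X Y : finType) (E : {set X * Y}) (y : Y) : {set X} :=
  [set x | (x, y) \in E].

(* Main.v *)
Require Import Defs.
From mathcomp Require Import all_boot all_order all_algebra.
From mathcomp Require Import reals sequences exp.

Import Order.TTheory GRing.Theory Num.Theory.
Local Open Scope ring_scope.

(** Pointwise, P(x,y) <= P_X(x) * max_x' P_{Y|X}(y|x'). Summing over the fiber
    E_y and then over y bounds P(E) by alpha times the sum of the maxima. The
    instance E = X * Y, alpha = 1 shows that this sum is positive, so that it is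
    the exponential of the leakage. *)

Lemma marginalX_ge0 {R : realType} {X Y : finType} {P : X * Y -> R}
    (P_ge0 : forall t, 0 <= P t) (x : X) : 0 <= marginalX P x.
Proof. exact: sumr_ge0. Qed.

Lemma sum_marginalX {R : realType} {X Y : finType} (P : X * Y -> R) :
  \sum_x marginalX P x = \sum_t P t.
Proof. by rewrite pair_bigA; apply: eq_bigr => -[]. Qed.

Lemma Pr_fiber {R : realType} {X Y : finType} (P : X * Y -> R)
    (E : {set X * Y}) :
  Pr P E = \sum_y \sum_(x in fiber E y) P (x, y).
Proof.
rewrite (exchange_big_dep xpredT) //= pair_big_dep /=.
by apply: eq_big => [[x y]|[x y] _] //=; rewrite inE.
Qed.

Lemma le_marginalX_bigmax {R : realType} {X Y : finType} {P : X * Y -> R}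
    (P_ge0 : forall t, 0 <= P t) (x : X) (y : Y) :
  P (x, y) <= marginalX P x *
    \big[Order.max/0]_(x' : X | 0 < marginalX P x') condYX P y x'.
Proof.
have := marginalX_ge0 P_ge0 x; rewrite le_eqVlt => /orP[/eqP PX0|PX_gt0].
  (* Here [x] is outside the range of the maximum, but [P (x, y)] is one term of a nonnegative sum
     equal to 0. *)
  rewrite -PX0 mul0r [leRHS]PX0 /marginalX (bigD1 y) //= lerDl.
  exact: sumr_ge0.
rewrite mulrC -ler_pdivrMr //.
exact: (le_bigmax_cond _ (condYX P y)).
Qed.

(** Stated for the sum itself, since it also serves to show that this sum is positive, before [expR]
    and [ln] can cancel. *)
Lemma Pr_le_sum_bigmax {R : realType} {alpha : R} {X Y : finType}
    {P : X * Y -> R} {E : {set X * Y}} (P_ge0 : forall t, 0 <= P t)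
    (E_small : forall y : Y, Pr (marginalX P) (fiber E y) <= alpha) :
  Pr P E <= alpha *
    \sum_(y : Y) \big[Order.max/0]_(x : X | 0 < marginalX P x) condYX P y x.
Proof.
rewrite Pr_fiber mulr_sumr; apply: ler_sum => y _.
set M := \big[Order.max/0]_(x | _) _.
(* The default value 0 of the maximum gives the sign needed to multiply [E_small] by [M]. *)
have M_ge0 : 0 <= M by exact: bigmax_ge_id.
apply: le_trans (ler_wpM2r M_ge0 (E_small y)).
by rewrite /Pr mulr_suml; apply: ler_sum => x _; exact: le_marginalX_bigmax.
Qed.

Theorem theorem2 (R : realType) (alpha : R) (X Y : finType) (P : X * Y -> R)
    (E : {set X * Y}) (alpha_ge0 : 0 <= alpha) (alpha_le1 : alpha <= 1)
    (P_dist : is_dist P)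
    (E_small : forall y : Y, Pr (marginalX P) (fiber E y) <= alpha) :
  Pr P E <= alpha * expR (maximal_leakage P).
Proof.
have [P_ge0 P_sum1] := P_dist.
rewrite /maximal_leakage lnK; first exact: Pr_le_sum_bigmax.
(* The sum is in fact at least 1; the factor 1 put in front plays the part of [alpha]. *)
rewrite posrE (lt_le_trans ltr01) // -[leRHS]mul1r.
have PrT : Pr P setT = 1.
  by rewrite -P_sum1; apply: eq_bigl => t; rewrite inE.
rewrite -[leLHS]PrT; apply: Pr_le_sum_bigmax => // y.
(* Each fiber of [setT] is all of [X], so its mass is exactly 1. *)
rewrite -P_sum1 -sum_marginalX le_eqVlt; apply/orP; left; apply/eqP.
by apply: eq_bigl => x; rewrite !inE.
Qed.
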